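(* For every integer $n\ge 1$, one has $\mathcal{X}_{2n}=\mathrm{Kr}(\mathcal{Y}_{2n})$, where $\mathrm{Kr}:\mathcal{NC}(2n)\to\mathcal{NC}(2n)$ is the Kreweras complementation map.
   Context: $[m]:=\{1,\dots,m\}$ and $\mathcal{NC}(m)$ is the set of non-crossing partitions of $[m]$, ordered by reverse refinement ($\pi\le\sigma$ if every block of $\sigma$ is a union of blocks of $\pi$). Kreweras complement: for $\pi\in\mathcal{NC}(m)$, $\mathrm{Kr}(\pi)$ is the biggest $\rho\in\mathcal{NC}(m)$ such that the partition of $[2m]$ obtained by placing $\pi$ on the positions $1,3,\dots,2m-1$ (element $i$ at position $2i-1$) and $\rho$ on the positions $2,4,\dots,2m$ (element $i$ at position $2i$) is non-crossing. Graph of a partition: for $\pi\in\mathcal{NC}(2n)$, the undirected graph $\mathcal{G}_\pi$ (loops and multiple edges allowed) has as vertices the blocks of $\pi$, and for each $k=1,\dots,n$ one edge joining the block containing $2k-1$ and the block containing $2k$; so it has exactly $n$ edges. $\mathcal{X}_{2n}:=\{\pi\in\mathcal{NC}(2n): \mathcal{G}_\pi \text{ is connected and bipartite}\}$. $\mathcal{Y}_{2n}$ is the set of non-crossing partitions of $[2n]$ of the form $\sigma=\{B_1,B_3,\dots,B_{2n-1},E_1,\dots,E_r\}$ with $r\ge 0$ (listed blocks pairwise distinct), where $i\in B_i$ for $i=1,3,\dots,2n-1$ and $|E_j|$ is even for $j\le r$. Equivalently: distinct odd elements lie in distinct blocks of $\sigma$, and every block consisting only of even elements has even size. *)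

(* Defs.v *)
From mathcomp Require Import all_boot.

Set Implicit Arguments.
Unset Strict Implicit.
Unset Printing Implicit Defensive.

(* The set [m] = {1, ..., m} is represented by 'I_m, the                       *)
(* element i of [m] being the ordinal of value i - 1. In particular the ODD   *)
(* elements 1, 3, ..., 2n-1 of [2n] are the ordinals of EVEN value in         *)
(* 'I_(n.*2).                                                                 *)

Lemma ltn_double_ord n (k : 'I_n) : k.*2 < n.*2.
Proof. by rewrite ltn_double ltn_ord. Qed.

Lemma ltn_Sdouble_ord n (k : 'I_n) : k.*2.+1 < n.*2.
Proof. by rewrite ltn_Sdouble ltn_ord. Qed.

(* For the k-th element of [n], counted from 1: 2k-1 and 2k in [2n].          *)
Definition odd_pos n (k : 'I_n) : 'I_(n.*2) := Ordinal (ltn_double_ord k).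
Definition even_pos n (k : 'I_n) : 'I_(n.*2) := Ordinal (ltn_Sdouble_ord k).

Definition noncrossing m (P : {set {set 'I_m}}) : bool :=
  [forall A in P, forall B in P,
   forall a : 'I_m, forall b : 'I_m, forall c : 'I_m, forall d : 'I_m,
     [&& a < b, b < c, c < d, a \in A, c \in A, b \in B & d \in B]
       ==> (A == B)].

Definition NC m : {set {set {set 'I_m}}} :=
  [set P | partition P [set: 'I_m] && noncrossing P].

Definition nc_le m (P Q : {set {set 'I_m}}) : bool :=
  [forall B in Q, exists R : {set {set 'I_m}}, (R \subset P) && (B == cover R)].

Definition interleave m (P Q : {set {set 'I_m}}) : {set {set 'I_(m.*2)}} :=
  [set @odd_pos m @: (B : {set 'I_m}) | B in P]
    :|: [set @even_pos m @: (B : {set 'I_m}) | B in Q].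

Definition kr_admissible m (P Q : {set {set 'I_m}}) : bool :=
  (Q \in NC m) && (interleave P Q \in NC m.*2).

Definition is_kreweras m (P Q : {set {set 'I_m}}) : bool :=
  kr_admissible P Q &&
  [forall R : {set {set 'I_m}}, kr_admissible P R ==> nc_le R Q].

(* The default value set0 is not a partition of [m] for m > 0, so it can      *)
(* never be mistaken for a genuine complement.                                *)
Definition Kr m (P : {set {set 'I_m}}) : {set {set 'I_m}} :=
  odflt set0 [pick Q | is_kreweras P Q].

(* Undirected multigraphs: E indexes the edges, so that parallel edges are    *)
(* allowed, and an edge with equal ends is a loop. The order of the two ends  *)
(* is immaterial in the notions below.                                        *)
Record multigraph (V E : finType) := Multigraph {
  vertices : {set V};
  ends : E -> V * V }.

Definition adjacent (V E : finType) (G : multigraph V E) : rel V :=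
  fun u v => [exists e, (ends G e == (u, v)) || (ends G e == (v, u))].

Definition connected (V E : finType) (G : multigraph V E) : bool :=
  (vertices G != set0) &&
  [forall u in vertices G, forall v in vertices G, connect (adjacent G) u v].

Definition bipartite (V E : finType) (G : multigraph V E) : bool :=
  [exists U : {set V}, (U \subset vertices G) &&
   [forall e, ((ends G e).1 \in U) != ((ends G e).2 \in U)]].

Definition partition_graph n (P : {set {set 'I_(n.*2)}}) :
    multigraph {set 'I_(n.*2)} 'I_n :=
  Multigraph P (fun k => (pblock P (odd_pos k), pblock P (even_pos k))).

Definition X n : {set {set {set 'I_(n.*2)}}} :=
  [set P in NC n.*2 |
    connected (partition_graph P) && bipartite (partition_graph P)].

(* B k is the block named B_(2k-1) (k counted from 1), and E is the set       *)
(* {E_1, ..., E_r}.                                                           *)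
Definition Y n : {set {set {set 'I_(n.*2)}}} :=
  [set P in NC n.*2 |
    [exists B : {ffun 'I_n -> {set 'I_(n.*2)}},
     exists E : {set {set 'I_(n.*2)}},
      [&& P == [set B k | k : 'I_n] :|: E,
          injectiveb B,
          [disjoint [set B k | k : 'I_n] & E],
          [forall k, odd_pos k \in B k]
        & [forall A in E, ~~ odd #|A : {set 'I_(n.*2)}|]]]].

(* Main.v *)
Require Import Defs.
From mathcomp Require Import all_boot zify.

Set Implicit Arguments.
Unset Strict Implicit.
Unset Printing Implicit Defensive.

(** A function [f : [m] -> F_2] has a cyclic difference
    [df(x) = f(x) - f(x - 1)].  For a non-crossing [P], the blocks of the
    Kreweras complement are described by intervals: [i < j] lie in the same
    block of [Kr P] exactly when the interval [(i, j]] is a union of blocks of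
    [P].  Indeed a block of [P] meeting both the interval and its complement
    is what crosses a link between [i] and [j] in the interleaving
    ([interleave_noncrossing]).  As the sum of [df] over [(i, j]] is [f(j) - f(i)], this yields the
    duality on which the proof rests: [f] is constant on the blocks of [Kr P]
    if and only if [df] sums to [0] over every block of [P]
    ([sum_block_difference] and [prefix_sum_invariant]).

    Both conditions on the graph of [Q = Kr P] are about functions constant on
    the blocks of [Q], that is, functions on the vertices.  The graph is
    bipartite when some such [f] has [df = 1] at every even element; through
    the duality, this asks for values of [df] at the odd elements making every
    block of [P] sum to [0], which is possible exactly when the blocks without
    odd elements have even size.  The graph is connected when every such [f]
    with [df = 0] at the even elements is constant; through the duality, this
    says that a function supported on the odd elements and summing to [0] over
    every block of [P] vanishes, that is, that no block of [P] contains two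
    odd elements.  Together these are the conditions defining the set [Y]
    ([kreweras_in_X]).

    It remains to know that every non-crossing partition is a Kreweras
    complement.  The inverse map is obtained by exchanging the roles of the two
    interleaved copies of [[m]] ([inverse_krewerasK]).  Throughout, intervals
    are replaced by cuts: whether [u] and [v] are separated by the cut after
    [i] is the boolean [(u <= i) (+) (v <= i)], and [(i, j]] is a union of
    blocks when the cuts after [i] and after [j] separate the same pairs of
    elements that share a block.  This is visibly an equivalence relation, and
    it treats [i < j] and [j < i] alike. *)

(** * Partitions as equivalence relations *)

Definition same (T : finType) (P : {set {set T}}) : rel T :=
  fun x y => pblock P x == pblock P y.

Lemma same_sym (T : finType) (P : {set {set T}}) : symmetric (same P).
Proof. by move=> x y; rewrite /same eq_sym. Qed.

Lemma mem_same (T : finType) (P : {set {set T}}) (A : {set T}) x y :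
  partition P setT -> A \in P -> x \in A -> (y \in A) = same P x y.
Proof.
move=> /and3P[/eqP covP trP _] AP xA.
by rewrite /same eq_pblock ?covP ?inE // (def_pblock trP AP xA).
Qed.

Lemma pblock_in (T : finType) (P : {set {set T}}) x :
  partition P setT -> pblock P x \in P.
Proof. by case/and3P=> /eqP covP _ _; rewrite pblock_mem // covP inE. Qed.

Lemma mem_pblockT (T : finType) (P : {set {set T}}) x :
  partition P setT -> x \in pblock P x.
Proof. by case/and3P=> /eqP covP _ _; rewrite mem_pblock covP inE. Qed.

Lemma block_witness (T : finType) (P : {set {set T}}) A :
  partition P setT -> A \in P -> {x | x \in A & A = pblock P x}.
Proof.
case/and3P=> _ trP nP AP.
have /sigW[x xA] : exists x, x \in A.
  by apply/set0Pn; apply: contraNneq nP => <-.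
by exists x => //; rewrite (def_pblock trP AP xA).
Qed.

Lemma partition_of_rel (T : finType) (P : {set {set T}}) (r : rel T) :
  equivalence_rel r -> P = equivalence_partition r setT ->
  partition P setT * (same P =2 r).
Proof.
move=> eqr ->.
have e3 : {in [set: T] & &, equivalence_rel r} by move=> x y z _ _ _; apply: eqr.
have hP := equivalence_partitionP e3; split=> // x y.
by rewrite -(mem_same _ hP (pblock_in x hP)) ?mem_pblockT //
           pblock_equivalence_partition ?inE.
Qed.

Lemma eq_same_partition (T : finType) (P Q : {set {set T}}) :
  partition P setT -> partition Q setT -> same P =2 same Q -> P = Q.
Proof.
move=> hP hQ PQ.
rewrite -(equivalence_partition_pblock hP) -(equivalence_partition_pblock hQ).
apply: eq_imset => x; apply/setP=> y; rewrite !inE.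
by rewrite (mem_same y hP (pblock_in x hP) (mem_pblockT x hP))
           (mem_same y hQ (pblock_in x hQ) (mem_pblockT x hQ)) PQ.
Qed.

Lemma noncrossingP m (P : {set {set 'I_m}}) : partition P setT ->
  reflect (forall a b c d : 'I_m, a < b -> b < c -> c < d ->
             same P a c -> same P b d -> same P a b) (noncrossing P).
Proof.
move=> hP; apply: (iffP idP) => [nc a b c d ab bc cd ac bd | nc].
  move/forall_inP/(_ _ (pblock_in a hP)): nc.
  move=> /forall_inP/(_ _ (pblock_in b hP)).
  move=> /'forall_'forall_'forall_'forall_implyP /(_ a b c d); apply.
  by rewrite ab bc cd !mem_pblockT // !(mem_same _ hP (pblock_in _ hP) (mem_pblockT _ hP)) ac.
apply/forall_inP => A AP; apply/forall_inP=> B BP.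
apply/'forall_'forall_'forall_'forall_implyP => a b c d.
case/and5P=> ab bc cd aA /and3P[cA bB dB].
case/and3P: (hP) => _ trP _.
rewrite -(def_pblock trP AP aA) -(def_pblock trP BP bB).
apply: (nc a b c d) => //.
  by rewrite -(mem_same _ hP AP aA).
by rewrite -(mem_same _ hP BP bB).
Qed.

Lemma nc_leP m (P Q : {set {set 'I_m}}) :
  partition P setT -> partition Q setT ->
  reflect (forall x y, same P x y -> same Q x y) (nc_le P Q).
Proof.
move=> hP hQ; case/and3P: (hP) => _ trP _.
apply: (iffP idP) => [le x y xy | le].
  move/forall_inP/(_ _ (pblock_in x hQ))/existsP: le => [R /andP[/subsetP RP /eqP cR]].
  rewrite -(mem_same y hQ (pblock_in x hQ) (mem_pblockT x hQ)) cR.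
  have := mem_pblockT x hQ; rewrite {1}cR => /bigcupP[A AR xA].
  by apply/bigcupP; exists A; rewrite // (mem_same y hP (RP _ AR) xA).
apply/forall_inP=> B BQ; apply/existsP; exists [set A in P | A \subset B].
apply/andP; split; first by apply/subsetP=> A; rewrite inE => /andP[].
rewrite eqEsubset; apply/andP; split; apply/subsetP=> x.
  move=> xB; apply/bigcupP; exists (pblock P x); last exact: mem_pblockT.
  rewrite inE pblock_in //=; apply/subsetP=> y.
  rewrite (mem_same _ hP (pblock_in _ hP) (mem_pblockT _ hP)) => /le.
  by rewrite -(mem_same _ hQ BQ xB).
by case/bigcupP=> A; rewrite inE => /andP[_ /subsetP]; apply.
Qed.

(** * The Kreweras complement by cuts *)

Section Cut.
Variables (m : nat) (c : 'I_m -> pred 'I_m).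

(** [c i] is one side of a cut of the ground set; two cuts are related when
    they separate the same pairs of elements that share a block of [P]. *)
Definition cut_rel (P : {set {set 'I_m}}) : rel 'I_m := fun i j =>
  [forall u, forall v, same P u v ==> (c i u (+) c i v == c j u (+) c j v)].

Lemma cut_relP P i j :
  reflect (forall u v, same P u v -> c i u (+) c i v = c j u (+) c j v)
          (cut_rel P i j).
Proof.
apply: (iffP idP) => [/'forall_'forall_implyP h u v uv|h]; first exact/eqP/h.
by apply/'forall_'forall_implyP => u v uv; apply/eqP/h.
Qed.

Lemma cut_rel_equivalence P : equivalence_rel (cut_rel P).
Proof.
move=> i j k; split; first exact/cut_relP.
move/cut_relP=> ij; apply/cut_relP/cut_relP=> h u v uv.
  by rewrite -ij // h.
by rewrite ij // h.
Qed.

Definition cut_partition P := equivalence_partition (cut_rel P) setT.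

Lemma cut_partition_partition P : partition (cut_partition P) setT.
Proof. exact: (partition_of_rel (cut_rel_equivalence P) erefl).1. Qed.

Lemma same_cut_partition P : same (cut_partition P) =2 cut_rel P.
Proof. exact: (partition_of_rel (cut_rel_equivalence P) erefl).2. Qed.

Hypothesis c_mono : forall (i j u : 'I_m), i < j -> c i u -> c j u.

(** If nested cuts [x < y < z < t] satisfy [x ~ z] and [y ~ t], then a pair
    separated by [x] and [z] is separated by [y], which lies between them, and
    a pair separated by [y] and [t] is separated by [z], hence by [x]. *)
Lemma cut_partition_NC P : cut_partition P \in NC m.
Proof.
have hK := cut_partition_partition P.
rewrite inE hK; apply/(noncrossingP hK) => x y z t xy yz zt.
rewrite !same_cut_partition => /cut_relP xz /cut_relP yt; apply/cut_relP=> u v uv.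
move: (xz u v uv) (yt u v uv).
have := c_mono (u := u) xy; have := c_mono (u := v) xy.
have := c_mono (u := u) yz; have := c_mono (u := v) yz.
have := c_mono (u := u) zt; have := c_mono (u := v) zt.
by do 8!case: (c _ _) => // ; do ?[move=> /(_ isT) // | move=> _].
Qed.
End Cut.

(** In the interleaving, the element [i] of the even copy comes right after the
    element [i] of the odd copy: the cut at [i] in the even copy is
    [u <= i], and the cut at [i] in the odd copy is [u < i]. *)
Definition kreweras m := cut_partition (fun i u : 'I_m => u <= i).
Definition inverse_kreweras m := cut_partition (fun i u : 'I_m => u < i).

Lemma kreweras_NC m (P : {set {set 'I_m}}) : kreweras P \in NC m.
Proof. by apply: cut_partition_NC => i j u; lia. Qed.
Lemma inverse_kreweras_NC m (P : {set {set 'I_m}}) : inverse_kreweras P \in NC m.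
Proof. by apply: cut_partition_NC => i j u; lia. Qed.

Lemma NC_partition m (P : {set {set 'I_m}}) : P \in NC m -> partition P setT.
Proof. by rewrite inE => /andP[]. Qed.

Lemma same_kreweras m (P : {set {set 'I_m}}) (i j : 'I_m) :
  reflect (forall u v : 'I_m, same P u v ->
             (u <= i) (+) (v <= i) = (u <= j) (+) (v <= j))
          (same (kreweras P) i j).
Proof. by rewrite same_cut_partition; apply: cut_relP. Qed.
Lemma same_inverse_kreweras m (P : {set {set 'I_m}}) (i j : 'I_m) :
  reflect (forall u v : 'I_m, same P u v ->
             (u < i) (+) (v < i) = (u < j) (+) (v < j))
          (same (inverse_kreweras P) i j).
Proof. by rewrite same_cut_partition; apply: cut_relP. Qed.

(** * Interleaving two partitions *)

Lemma odd_pos_inj m : injective (@odd_pos m).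
Proof. by move=> x y /(congr1 val) /= /double_inj; apply: val_inj. Qed.
Lemma even_pos_inj m : injective (@even_pos m).
Proof. by move=> x y /(congr1 val) /= [] /double_inj; apply: val_inj. Qed.
Lemma odd_pos_even_pos m (x y : 'I_m) : odd_pos x <> even_pos y.
Proof. by move/(congr1 val) => /=; lia. Qed.

Variant pos_spec m : 'I_m.*2 -> Prop :=
| OddPos x : pos_spec (odd_pos x)
| EvenPos x : pos_spec (even_pos x).

Lemma posP m (i : 'I_m.*2) : pos_spec i.
Proof.
have lt : i./2 < m by have := ltn_ord i; lia.
case: (boolP (odd i)) => oi.
  suff -> : i = even_pos (Ordinal lt) by constructor.
  by apply: val_inj => /=; lia.
suff -> : i = odd_pos (Ordinal lt) by constructor.
by apply: val_inj => /=; lia.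
Qed.

Section Interleave.
Variables (m : nat) (P Q : {set {set 'I_m}}).
Hypotheses (hP : partition P setT) (hQ : partition Q setT).
Lemma interleave_odd B : B \in P -> @odd_pos m @: B \in interleave P Q.
Proof. by move=> BP; rewrite inE imset_f. Qed.
Lemma interleave_even B : B \in Q -> @even_pos m @: B \in interleave P Q.
Proof. by move=> BP; rewrite inE [X in _ || X]imset_f ?orbT. Qed.

Lemma partition_interleave : partition (interleave P Q) setT.
Proof.
case/and3P: (hP) => _ trP nP; case/and3P: (hQ) => _ trQ nQ.
apply/and3P; split.
- rewrite eqEsubset subsetT /=; apply/subsetP=> i _.
  case: (posP i) => x; apply/bigcupP.
    exists (@odd_pos m @: pblock P x); first exact/interleave_odd/pblock_in.
    exact/imset_f/mem_pblockT.
  exists (@even_pos m @: pblock Q x); first exact/interleave_even/pblock_in.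
  exact/imset_f/mem_pblockT.
- apply/trivIsetP => A B.
  case/setUP=> /imsetP[A' AP ->]; case/setUP=> /imsetP[B' BP ->] AB.
  + rewrite imset_disjoint; first last.
      exact: odd_pos_inj.
    by apply: (trivIsetP trP) => //; apply: contraNneq AB => ->.
  + apply/pred0P => i /=; apply/andP=> -[/imsetP[x _ ->] /imsetP[y _]].
    exact: odd_pos_even_pos.
  + apply/pred0P => i /=; apply/andP=> -[/imsetP[x _ ->] /imsetP[y _]].
    by move/esym; exact: odd_pos_even_pos.
  + rewrite imset_disjoint; first last.
      exact: even_pos_inj.
    by apply: (trivIsetP trQ) => //; apply: contraNneq AB => ->.
- apply/setUP=> -[] /imsetP[B BP] /esym/eqP; rewrite imset_eq0 => /eqP B0.
    by rewrite -B0 BP in nP.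
  by rewrite -B0 BP in nQ.
Qed.

Lemma same_odd_odd x y :
  same (interleave P Q) (odd_pos x) (odd_pos y) = same P x y.
Proof.
have hA := interleave_odd (pblock_in x hP).
rewrite -(mem_same _ partition_interleave hA (imset_f _ (mem_pblockT x hP))).
rewrite (mem_imset _ _ (@odd_pos_inj m)).
exact: mem_same (pblock_in x hP) (mem_pblockT x hP).
Qed.

Lemma same_even_even x y :
  same (interleave P Q) (even_pos x) (even_pos y) = same Q x y.
Proof.
have hA := interleave_even (pblock_in x hQ).
rewrite -(mem_same _ partition_interleave hA (imset_f _ (mem_pblockT x hQ))).
rewrite (mem_imset _ _ (@even_pos_inj m)).
exact: mem_same (pblock_in x hQ) (mem_pblockT x hQ).
Qed.

Lemma same_odd_even x y :
  same (interleave P Q) (odd_pos x) (even_pos y) = false.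
Proof.
have hA := interleave_odd (pblock_in x hP).
rewrite -(mem_same _ partition_interleave hA (imset_f _ (mem_pblockT x hP))).
by apply/imsetP => -[z _] /esym; apply: odd_pos_even_pos.
Qed.

Lemma same_even_odd x y :
  same (interleave P Q) (even_pos x) (odd_pos y) = false.
Proof. by rewrite /same eq_sym; apply: same_odd_even. Qed.

(** Two pairs [u ~ v] of [P] and [i ~ j] of [Q] cross in the interleaving
    exactly when one of the cuts after [i] and after [j] separates [u] from [v]
    and the other does not. *)
Lemma interleave_noncrossing : noncrossing P -> noncrossing Q ->
  reflect (forall i j, same Q i j -> same (kreweras P) i j)
          (noncrossing (interleave P Q)).
Proof.
move=> /(noncrossingP hP) ncP /(noncrossingP hQ) ncQ.
apply: (iffP (noncrossingP partition_interleave)) => [nc i j ij|le].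
  wlog lij : i j ij / i < j.
    move=> W; case: (ltngtP i j) => [/W||/val_inj ->].
    - exact.
    - by rewrite /same eq_sym => /W; apply; rewrite /same eq_sym.
    - by rewrite /same.
  apply/same_kreweras => u v.
  wlog luv : u v / u < v.
    move=> W; case: (ltngtP u v) => [/W||/val_inj ->]; first exact.
      by move=> /W h uv; rewrite addbC h 1?addbC // /same eq_sym.
    by rewrite !addbb.
  move=> uv; apply/eqP; apply: contraT => h.
  case: (leqP u i) h => ui h.
    have:= nc (odd_pos u) (even_pos i) (odd_pos v) (even_pos j).
    rewrite same_odd_odd same_even_even same_odd_even /=; apply => //; lia.
  have:= nc (even_pos i) (odd_pos u) (even_pos j) (odd_pos v).
  rewrite same_odd_odd same_even_even same_even_odd /=; apply => //; lia.
move=> a b c d; case: (posP a) => a'; case: (posP b) => b'; case: (posP c) => c';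
  case: (posP d) => d' ab bc cd;
  rewrite ?(same_odd_odd, same_even_even, same_odd_even, same_even_odd) //=.
- by apply: ncP; move: ab bc cd => /=; lia.
- move=> ac /le/same_kreweras/(_ _ _ ac); move: ab bc cd => /=; lia.
- move=> /le/same_kreweras h /h; move: ab bc cd => /=; lia.
- by apply: ncQ; move: ab bc cd => /=; lia.
Qed.
End Interleave.

Lemma kreweras_is_kreweras m (P : {set {set 'I_m}}) :
  P \in NC m -> is_kreweras P (kreweras P).
Proof.
rewrite inE => /andP[hP ncP].
have := kreweras_NC P; rewrite inE => /andP[hK ncK].
apply/andP; split.
  rewrite /kr_admissible kreweras_NC inE partition_interleave //=.
  exact/interleave_noncrossing.
apply/forall_inP=> R; rewrite /kr_admissible !inE.
case/andP=> /andP[hR ncR] /andP[_] /(interleave_noncrossing hP hR ncP ncR) le.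
exact/nc_leP.
Qed.

Lemma Kr_kreweras m (P : {set {set 'I_m}}) : P \in NC m -> Kr P = kreweras P.
Proof.
move=> hP; have kP := kreweras_is_kreweras hP.
rewrite /Kr; case: pickP => [Q kQ /=|/(_ (kreweras P))]; last by rewrite kP.
have part R : is_kreweras P R -> partition R setT.
  by case/andP=> /andP[/NC_partition].
have le R R' : is_kreweras P R -> is_kreweras P R' ->
    forall x y, same R x y -> same R' x y.
  move=> kR kR'; apply/(nc_leP (part _ kR) (part _ kR')).
  by case/andP: kR' => _ /forall_inP; apply; case/andP: kR.
apply: eq_same_partition; [exact: part|exact: part|] => x y.
by apply/idP/idP; apply: le.
Qed.

(** * Consecutive elements of a block *)

Lemma ord_predE m (i : 'I_m) : nat_of_ord (ord_pred i) = if i == 0 :> nat then m.-1 else i.-1.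
Proof.
rewrite /=; have lt := ltn_ord i; case: eqP => [->|i0].
  by rewrite add0n modn_small //; lia.
have -> : (i + m).-1 = i.-1 + m by lia.
by rewrite modnDr modn_small //; lia.
Qed.

Lemma ordSE m (i : 'I_m) : nat_of_ord (ordS i) = if i.+1 == m then 0 else i.+1.
Proof.
rewrite /=; have lt := ltn_ord i; case: eqP => [->|i0]; first by rewrite modnn.
by rewrite modn_small //; lia.
Qed.

(** The cut after the last element and the cut before the first one separate no
    pair, so cuts are compatible with the cyclic order. *)
Lemma cut_ord_pred m (u v i : 'I_m) :
  (u <= ord_pred i) (+) (v <= ord_pred i) = (u < i) (+) (v < i).
Proof.
rewrite ord_predE; have := ltn_ord u; have := ltn_ord v.
case: ifP => [/eqP -> | i0] vm um; last by case: (nat_of_ord i) i0.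
by rewrite -(ltnS u) -(ltnS v) (ltn_predK um) um vm.
Qed.

Lemma cut_ordS m (u v i : 'I_m) :
  (u < ordS i) (+) (v < ordS i) = (u <= i) (+) (v <= i).
Proof. by rewrite -cut_ord_pred ordSK. Qed.

Lemma ordS_cut m (u i j : 'I_m) :
  (ordS u <= i) (+) (ordS u <= j) = (u < i) (+) (u < j).
Proof.
rewrite ordSE; have := ltn_ord i; have := ltn_ord j.
case: ifP => [/eqP um|_] // jm im.
by rewrite ![u < _]ltnNge -(ltnS i) -(ltnS j) um im jm.
Qed.

Section Gap.
Variables (m : nat) (A : {set 'I_m}).

(** [x] is the last element of [A] at or before [i] in the cyclic order.  The
    cuts after [x] and after [i] then have the same trace on [A], up to
    complementation when one has to wrap around to reach [x]; the right-hand
    side is the value of the left-hand one at [z = x]. *)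
Definition precedes (x i : 'I_m) :=
  (x \in A) && [forall z in A, ((z <= x) (+) (z <= i)) == ~~ (x <= i)].
(** [y] is the first element of [A] strictly after [i] in the cyclic order. *)
Definition succeeds (y i : 'I_m) :=
  (y \in A) && [forall z in A, ((z < y) (+) (z <= i)) == (y <= i)].

Lemma exists_precedes (i a : 'I_m) : a \in A -> exists x, precedes x i.
Proof.
move=> aA.
case: (pickP (fun x => (x \in A) && (x <= i))) => [b bA|none].
  case: (@arg_maxnP _ b (fun x => (x \in A) && (x <= i)) (@nat_of_ord m) bA) => x /andP[xA xi] xmax.
  exists x; rewrite /precedes xA; apply/forall_inP=> z zA.
  by have := xmax z; rewrite zA /=; lia.
case: (@arg_maxnP _ a (mem A) (@nat_of_ord m) aA) => x xA xmax.
exists x; rewrite /precedes; rewrite [x \in A]xA /=; apply/forall_inP=> z zA.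
have := xmax z zA; have := none z; have := none x; rewrite zA [x \in A]xA /=; lia.
Qed.

Lemma exists_succeeds (i a : 'I_m) : a \in A -> exists y, succeeds y i.
Proof.
move=> aA.
case: (pickP (fun x => (x \in A) && (i < x))) => [b bA|none].
  case: (@arg_minnP _ b (fun x => (x \in A) && (i < x)) (@nat_of_ord m) bA) => x /andP[xA xi] xmin.
  exists x; rewrite /succeeds xA; apply/forall_inP=> z zA.
  by have := xmin z; rewrite zA /=; lia.
case: (@arg_minnP _ a (mem A) (@nat_of_ord m) aA) => x xA xmin.
exists x; rewrite /succeeds; rewrite [x \in A]xA /=; apply/forall_inP=> z zA.
have := xmin z zA; have := none z; have := none x; rewrite zA [x \in A]xA /=; lia.
Qed.

Lemma precedes_inj x x' i : precedes x i -> precedes x' i -> x = x'.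
Proof.
case/andP=> xA /forall_inP hx /andP[x'A /forall_inP hx'].
by apply: val_inj => /=; move: (hx _ x'A) (hx' _ xA); lia.
Qed.

Lemma precedes_refl x : x \in A -> precedes x x.
Proof. by move=> xA; rewrite /precedes xA; apply/forall_inP => z _; lia. Qed.

Lemma precedes_pred x i : i \notin A -> precedes x i -> precedes x (ord_pred i).
Proof.
move=> iA /andP[xA /forall_inP hx]; rewrite /precedes xA; apply/forall_inP=> z zA.
have neq w : w \in A -> w <> i :> nat by move=> wA /val_inj wi; rewrite -wi wA in iA.
have := hx z zA; have := neq _ zA; have := neq _ xA; rewrite ord_predE.
by have := ltn_ord z; have := ltn_ord x; case: ifP; lia.
Qed.

Lemma precedes_predP x y : y \in A -> precedes x (ord_pred y) ->
  forall z, z \in A -> (z <= x) (+) (z < y) = ~~ (x < y).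
Proof.
move=> yA /andP[xA /forall_inP hx] z zA; have := hx z zA; rewrite ord_predE.
by have := ltn_ord z; have := ltn_ord x; case: ifP; lia.
Qed.

Lemma precedes_succeeds x y i : precedes x i -> succeeds y i ->
  forall z, z \in A -> (z <= x) (+) (z < y) = ~~ (x < y).
Proof.
move=> /andP[xA /forall_inP hx] /andP[yA /forall_inP hy] z zA.
have := hx z zA; have := hx y yA; have := hy z zA; have := hy x xA; lia.
Qed.
End Gap.

(** When [x] is followed in [A] by [y] in the cyclic order, the gap between
    them is a union of blocks, since a block leaving the gap would cross [A].
    Hence the cut after [x] and the cut before [y] separate the same pairs. *)
Lemma cut_consecutive m (P : {set {set 'I_m}}) (A : {set 'I_m}) (x y : 'I_m) :
  P \in NC m -> A \in P -> x \in A -> y \in A ->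
  (forall z, z \in A -> (z <= x) (+) (z < y) = ~~ (x < y)) ->
  forall u v, same P u v -> (u <= x) (+) (v <= x) = (u < y) (+) (v < y).
Proof.
rewrite inE => /andP[hP /(noncrossingP hP) nc] AP xA yA consec u v uv.
have uvA : (u \in A) = (v \in A).
  by rewrite !(mem_same _ hP AP xA) /same (eqP uv).
case uA: (u \in A).
  have := consec u uA; have vA : v \in A by rewrite -uvA.
  by have := consec v vA; lia.
wlog luv : u v uv uA uvA / u < v.
  move=> W; case: (ltngtP u v) => [l|l|/val_inj ->]; last by rewrite !addbb.
    exact: W.
  by rewrite addbC [RHS]addbC; apply: W => //; rewrite -?uvA // same_sym.
have vA : v \in A = false by rewrite -uvA.
have neqA w t : w \in A -> t \in A = false -> w != t :> nat.
  by move=> wA; apply: contraFneq => /val_inj <-.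
have := neqA x u xA uA; have := neqA y u yA uA.
have := neqA x v xA vA; have := neqA y v yA vA.
have cross_left w w' : w \in A -> w' \in A -> ~ (w < u /\ u < w' /\ w' < v).
  move=> wA w'A [wu [uw' w'v]]; have := nc _ _ _ _ wu uw' w'v.
  by rewrite -!(mem_same _ hP AP wA) w'A uA => /(_ isT uv).
have cross_right w w' : w \in A -> w' \in A -> ~ (u < w /\ w < v /\ v < w').
  move=> wA w'A [uw [wv vw']]; have := nc _ _ _ _ uw wv vw'.
  rewrite [same P u w]same_sym -!(mem_same _ hP AP wA) w'A uA.
  by move=> /(_ uv isT).
have := cross_left x y xA yA; have := cross_left y x yA xA.
have := cross_right x y xA yA; have := cross_right y x yA xA.
clear -luv; move=> r1 r2 l1 l2 ? ? ? ?.
case: (leqP u x) => ?; case: (leqP v x) => ?; case: (ltnP u y) => ?;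
  case: (ltnP v y) => ? //=; exfalso;
  solve [lia | apply: r1; lia | apply: r2; lia | apply: l1; lia | apply: l2; lia].
Qed.

(** If [i] and [j] lie in different blocks of [P], then [j] lies in a gap
    between two consecutive elements [x] and [y] of the block of [i].  The
    elements [x + 1] (cyclically) and [y] share a block of the inverse complement, and
    the cut after [j] separates them whereas the cut after [i] does not, or
    conversely. *)
Lemma inverse_krewerasK m (P : {set {set 'I_m}}) : P \in NC m ->
  kreweras (inverse_kreweras P) = P.
Proof.
move=> PNC; have hP := NC_partition PNC.
apply: eq_same_partition => //; first exact: cut_partition_partition.
move=> i j; apply/idP/idP; last first.
  move=> ij; apply/same_kreweras => u v /same_inverse_kreweras /(_ _ _ ij).
  by lia.
move/same_kreweras=> h; apply: contraT => nij.
pose B := pblock P i; have BP : B \in P := pblock_in i hP.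
have iB : i \in B := mem_pblockT i hP.
have jB : j \notin B by rewrite (mem_same _ hP BP iB).
have [x xj] := exists_precedes j iB; have [y yj] := exists_succeeds j iB.
have [[xB hx] [yB hy]] := (andP xj, andP yj).
have xy : same (inverse_kreweras P) (ordS x) y.
  apply/same_inverse_kreweras=> u v uv.
  by rewrite cut_ordS; apply: cut_consecutive (precedes_succeeds xj yj) _ _ uv.
have neq w : w \in B -> (w == j :> nat) = false.
  by move=> wB; apply: contraNF jB => /eqP/val_inj <-.
have := h _ _ xy.
suff : (x < i) (+) (x < j) != (y <= i) (+) (y <= j).
  by rewrite -ordS_cut; do 4!case: (_ <= _).
have := forall_inP hx i iB; have := forall_inP hy i iB.
rewrite (ltnNge i y) (ltnNge x i) (ltn_neqAle x j) (neq _ xB) /=.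
by do 5!case: (_ <= _).
Qed.

(** * Invariant functions and sums over blocks *)

(** Let [g i] be the last element of [A] at or before [i].  For [a] in [A], the
    gap before [a] is a union of blocks of [P], so [f] takes the same value at
    [a - 1] and at [g (a - 1)]; outside [A], [g] does not change from [i - 1]
    to [i].  The sum over [A] is therefore the sum over all [i] of the
    difference of [f \o g], which vanishes on the cycle. *)
Lemma sum_block_difference m (P : {set {set 'I_m}}) (f : 'I_m -> bool) A :
  P \in NC m -> (forall i j, same (kreweras P) i j -> f i = f j) -> A \in P ->
  \big[addb/false]_(a in A) (f a (+) f (ord_pred a)) = false.
Proof.
move=> PNC finv AP; have hP := NC_partition PNC.
have [a0 a0A _] := block_witness hP AP.
have [g gP] : exists g, forall i, precedes A (g i) i.
  exact: (fin_all_exists (fun i => exists_precedes i a0A)).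
have gA a : a \in A -> g a = a.
  by move=> aA; exact: (precedes_inj (gP a) (precedes_refl aA)).
have gpred a : a \in A -> f (g (ord_pred a)) = f (ord_pred a).
  move=> aA; apply: finv; apply/same_kreweras => u v uv.
  have xA : g (ord_pred a) \in A by case/andP: (gP (ord_pred a)).
  by rewrite cut_ord_pred; apply: cut_consecutive (precedes_predP aA (gP _)) _ _ uv.
transitivity (\big[addb/false]_i (f (g i) (+) f (g (ord_pred i)))).
  rewrite [RHS](bigID (mem A)) /= [X in _ = _ (+) X]big1 => [|i iA].
    by rewrite addbF; apply: eq_bigr => a aA; rewrite gA // gpred.
  by rewrite (precedes_inj (precedes_pred iA (gP i)) (gP _)) addbb.
rewrite big_split /= -(reindex (@ord_pred m) (P := xpredT) (F := fun i => f (g i))) ?addbb //.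
exact/onW_bij/ord_pred_bij.
Qed.

(** The difference of the two prefix sums is the sum of [g] over a union of
    blocks of [P]. *)
Lemma prefix_sum_invariant m (P : {set {set 'I_m}}) (g : 'I_m -> bool) i j :
  partition P setT ->
  (forall A, A \in P -> \big[addb/false]_(a in A) g a = false) ->
  same (kreweras P) i j ->
  \big[addb/false]_(x : 'I_m | x <= i) g x = \big[addb/false]_(x : 'I_m | x <= j) g x.
Proof.
move=> hP g0 /same_kreweras ij; apply/eqP; rewrite -[_ == _]negbK negb_eqb; apply/negbT.
rewrite !(big_mkcond (fun x : 'I_m => x <= _)) -big_split /=.
have -> : \big[addb/false]_(x : 'I_m) ((if x <= i then g x else false) (+) (if x <= j then g x else false))
     = \big[addb/false]_(x in [set: 'I_m]) (((x <= i) (+) (x <= j)) && g x).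
  by apply: eq_big => [x|x _]; [rewrite inE | do 2!case: (x <= _); case: (g x)].
rewrite (set_partition_big _ hP) big1 // => A AP.
have [a aA _] := block_witness hP AP.
transitivity (\big[addb/false]_(x in A) (((a <= i) (+) (a <= j)) && g x)).
  apply: eq_bigr => x xA; congr andb.
  by have := ij a x; rewrite -(mem_same _ hP AP aA) => /(_ xA); lia.
by case: (_ (+) _); [exact: g0 | exact: big1].
Qed.

Lemma sum_true (T : finType) (A : {pred T}) :
  \big[addb/false]_(x in A) true = odd #|A|.
Proof. by rewrite -sum1_card (big_morph odd oddD (erefl : odd 0 = false)). Qed.

(** * The graph conditions and the set Y *)

(** A proper 2-colouring of the blocks, pulled back to the ground set. *)
Lemma bipartiteP n (P : {set {set 'I_n.*2}}) : partition P setT ->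
  reflect (exists2 f : 'I_n.*2 -> bool, (forall i j, same P i j -> f i = f j)
             & forall k, f (odd_pos k) != f (even_pos k))
          (bipartite (partition_graph P)).
Proof.
move=> hP; apply: (iffP existsP) => [[U /andP[_ /forallP hU]]|[f finv hf]].
  by exists (fun i => pblock P i \in U) => // i j /eqP ->.
have memU i : (pblock P i \in [set pblock P j | j in f]) = f i.
  apply/imsetP/idP => [[j fj /eqP /finv ->] //|fi].
  by exists i.
exists [set pblock P j | j in f]; apply/andP; split; last first.
  by apply/forallP => k /=; rewrite !memU.
by apply/subsetP => B /imsetP[j _ ->]; apply: pblock_in.
Qed.

(** A function as in the criterion is a function on the vertices constant along
    every edge; the converse uses the indicator of a connected component. *)
Lemma connectedP n (P : {set {set 'I_n.*2}}) : 0 < n -> partition P setT ->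
  reflect (forall f : 'I_n.*2 -> bool, (forall i j, same P i j -> f i = f j) ->
             (forall k, f (odd_pos k) = f (even_pos k)) -> forall i j, f i = f j)
          (connected (partition_graph P)).
Proof.
move=> n0 hP; apply: (iffP andP) => [[_ /forall_inP con] f finv fk i j|const].
  pose U := [set pblock P j | j in f].
  have memU l : (pblock P l \in U) = f l.
    apply/imsetP/idP => [[l' fl /eqP /finv ->] //|fi].
    by exists l.
  have clU : closed (adjacent (partition_graph P)) U.
    by move=> u v /existsP[k] /orP[] /eqP[<- <-]; rewrite !memU fk.
  move/(_ _ (pblock_in i hP))/forall_inP/(_ _ (pblock_in j hP)): con.
  by move/(closed_connect clU); rewrite !memU.
split.
  by apply/set0Pn; exists (pblock P (odd_pos (Ordinal n0))); exact: pblock_in.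
apply/forall_inP => u /(block_witness hP)[i _ ->].
apply/forall_inP => v /(block_witness hP)[j _ ->].
rewrite -(const (fun l => connect (adjacent (partition_graph P)) (pblock P i) (pblock P l))
             _ _ i j) ?connect0 //; first by move=> ? ? /eqP ->.
move=> k; apply/idP/idP => /connect_trans; apply; apply: connect1;
  by apply/existsP; exists k; rewrite /= eqxx ?orbT.
Qed.

Lemma mem_YP n (P : {set {set 'I_n.*2}}) :
  reflect [/\ P \in NC n.*2,
              forall k l, same P (odd_pos k) (odd_pos l) -> k = l
            & forall A, A \in P -> (forall k, odd_pos k \notin A) -> ~~ odd #|A|]
          (P \in Y n).
Proof.
rewrite [_ \in Y n]in_set; apply: (iffP andP) => [[PNC]|[PNC oddP evenP]]; have hP := NC_partition PNC.
  case/existsP=> B /existsP[E] /and5P[/eqP PBE /injectiveP injB _ /forallP kB /forall_inP evE].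
  have BP k : B k \in P by rewrite PBE inE imset_f.
  have pbB k : pblock P (odd_pos k) = B k.
    by case/and3P: hP => _ trP _; apply: def_pblock.
  split=> // [k l|A]; first by rewrite /same !pbB => /eqP/injB.
  rewrite {1}PBE => /setUP[/imsetP[k _ ->] /(_ k)|/evE //]; by rewrite kB.
split=> //; pose B := [ffun k => pblock P (odd_pos k)].
apply/existsP; exists B; apply/existsP; exists (P :\: [set B k | k : 'I_n]).
have BP : [set B k | k : 'I_n] \subset P.
  by apply/subsetP => A /imsetP[k _ ->]; rewrite ffunE pblock_in.
apply/and5P; split.
- by rewrite setDE setUIr setUCr setIT (setUidPr BP).
- by apply/injectiveP => k l; rewrite !ffunE => /eqP/oddP.
- by rewrite disjoint_sym disjoints_subset setDE subsetIr.
- by apply/forallP => k; rewrite ffunE mem_pblockT.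
apply/forall_inP => A /setDP[AP AB]; apply: evenP => // k.
apply: contra AB => kA; apply/imsetP; exists k => //; rewrite ffunE.
by case/and3P: hP => _ trP _; rewrite (def_pblock trP AP kA).
Qed.

(** * The main equivalence *)

(** Two odd elements of one block of [P] give the function
    [i |-> (odd_pos k <= i) (+) (odd_pos l <= i)], which is constant on the
    blocks of the complement by definition and disproves connectedness; the
    other three implications follow from the duality between invariant
    functions and sums over blocks. *)
Lemma kreweras_in_X n (P : {set {set 'I_n.*2}}) : 0 < n -> P \in NC n.*2 ->
  (kreweras P \in X n) = (P \in Y n).
Proof.
move=> n0 PNC; have hP := NC_partition PNC.
have hK : partition (kreweras P) setT := cut_partition_partition _ _.
have pred_even k : ord_pred (even_pos k) = odd_pos k :> 'I_n.*2.
  by apply: val_inj; rewrite [LHS]ord_predE.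
rewrite [_ \in X n]in_set kreweras_NC /=; apply/andP/mem_YP => [[con bip]|[_ oddP evenP]].
  split=> // [k l kl|A AP oddA].
    wlog lkl : k l kl / k < l.
      move=> W; case: (ltngtP k l) => [/W->|/W h|/val_inj] //.
      by symmetry; apply: h; rewrite same_sym.
    pose f (i : 'I_n.*2) := (odd_pos k <= i) (+) (odd_pos l <= i).
    have finv i j : same (kreweras P) i j -> f i = f j.
      by move=> /same_kreweras; apply.
    have fk t : f (odd_pos t) = f (even_pos t).
      by rewrite /f /= !leq_Sdouble !leq_double.
    have := connectedP n0 hK con f finv fk (odd_pos k) (odd_pos l).
    by rewrite /f /= !leqnn !leq_double (ltnW lkl) leqNgt lkl.
  case/(bipartiteP hK): bip => f finv fk.
  apply/negbT; rewrite -sum_true -[RHS](sum_block_difference PNC finv AP).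
  apply: eq_bigr => a aA.
  case: (posP a) aA => k kA; first by case/negP: (oddA k).
  by rewrite pred_even; move: (fk k); do 2!case: (f _).
split.
  apply/(connectedP n0 hK) => f finv fk.
  have step i : f i = f (ord_pred i).
    case: (posP i) => k; last by rewrite pred_even fk.
    have := sum_block_difference PNC finv (pblock_in (odd_pos k) hP).
    rewrite (bigD1 (odd_pos k)) ?mem_pblockT //= big1 ?addbF => [|a /andP[aA]].
      by do 2!case: (f _).
    case: (posP a) aA => l; last by rewrite pred_even fk addbb.
    rewrite (mem_same _ hP (pblock_in _ hP) (mem_pblockT _ hP)) => /oddP ->.
    by rewrite eqxx.
  have const i : f i = f (odd_pos (Ordinal n0)).
    case: i => i; elim: i => [|i IH] lt.
      by congr f; apply: val_inj.
    rewrite step -(IH (ltnW lt)); congr f; apply: val_inj.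
    by rewrite [LHS]ord_predE.
  by move=> i j; rewrite !const.
apply/(bipartiteP hK).
(* The prescribed difference is 1 at the even elements (the ordinals of odd
   value); at the odd element of a block it is chosen so that the block sums
   to 0. *)
pose g (x : 'I_n.*2) := odd x || ~~ odd #|pblock P x|.
have g0 A : A \in P -> \big[addb/false]_(a in A) g a = false.
  move=> AP; case: (pickP (fun k => odd_pos k \in A)) => [k kA|noodd].
    rewrite (bigD1 (odd_pos k)) //= (eq_bigr (fun=> true)).
      rewrite (eq_bigl (mem (A :\ odd_pos k))) => [|a]; last by rewrite !inE andbC.
      rewrite sum_true /g /= odd_double /=.
      case/and3P: (hP) => _ trP _; rewrite (def_pblock trP AP kA).
      by rewrite (cardsD1 (odd_pos k) A) kA /=; case: odd.
    move=> a /andP[aA]; case: (posP a) aA => l; last by rewrite /g /= odd_double.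
    by rewrite (mem_same _ hP AP kA) => /oddP ->; rewrite eqxx.
  rewrite (eq_bigr (fun=> true)).
    by rewrite sum_true; apply/negbTE/evenP => // k; rewrite noodd.
  by move=> a; case: (posP a) => l; [rewrite noodd | rewrite /g /= odd_double].
exists (fun i => \big[addb/false]_(x : 'I_n.*2 | x <= i) g x).
  by move=> i j; apply: prefix_sum_invariant.
move=> k; rewrite [X in _ != X](bigD1 (even_pos k)) //=.
rewrite {2}/g /= odd_double /=.
rewrite [X in _ != ~~ X](eq_bigl (fun x : 'I_n.*2 => x <= odd_pos k)); last first.
  move=> x; rewrite -(inj_eq val_inj) /=; lia.
by case: (\big[_/_]_(_ | _) _).
Qed.

Theorem proposition1p2 (n : nat) (hn : 1 <= n) :
  X n = [set Kr P | P in Y n].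
Proof.
apply/setP => Q; apply/idP/imsetP => [QX|[P PY ->]].
  have QNC : Q \in NC n.*2 by move: QX; rewrite [_ \in X n]in_set => /andP[].
  have PNC := inverse_kreweras_NC Q.
  exists (inverse_kreweras Q); last by rewrite Kr_kreweras ?inverse_krewerasK.
  by rewrite -kreweras_in_X // inverse_krewerasK.
have PNC : P \in NC n.*2 by case/mem_YP: PY.
by rewrite Kr_kreweras // kreweras_in_X.
Qed.
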